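(* Let $f$ be a spectral density on $\Lambda=[-\pi,\pi]$ and let $\overline{E_f}$ be the closure of its spectrum $E_f=\{e^{i\lambda}: f(\lambda)>0\}\subset\mathbb T$. Assume that $\overline{E_f}$ is the union of finitely many closed arcs of the unit circle $\mathbb{T}$ and that $f>0$ almost everywhere on $\{\lambda: e^{i\lambda}\in\overline{E_f}\}$. Then the sequence $\sqrt[n]{\sigma_n(f)}$ converges and $$\lim_{n\to\infty}\sqrt[n]{\sigma_n(f)}=\tau(\overline{E_f}),$$ where $\tau$ denotes the transfinite diameter.
   Context: $\Lambda=[-\pi,\pi]$, $\mathbb T=\{z\in\mathbb C:|z|=1\}$. A spectral density is a function $f\ge 0$, $f\in L^1(\Lambda)$, positive on a set of positive Lebesgue measure; its covariances are $r(t)=\int_\Lambda e^{-it\lambda}f(\lambda)\,d\lambda$. For $n\in\mathbb N$ the finite (one-step) prediction error is $\sigma_n^2(f)=\min_{c_1,\dots,c_n\in\mathbb C}\int_\Lambda\big|1-\sum_{k=1}^n c_k e^{-ik\lambda}\big|^2 f(\lambda)\,d\lambda$ (the mean squared error of the best linear predictor of $X(0)$ from $X(-n),\dots,X(-1)$ for a stationary sequence $X$ with spectral density $f$), and $\sigma_n(f)=\sqrt{\sigma_n^2(f)}$. Transfinite diameter: for a compact $F\subset\mathbb C$ and $n\ge2$, $d_n(F)=\max_{z_1,\dots,z_n\in F}\big(\prod_{1\le j<k\le n}|z_j-z_k|\big)^{2/(n(n-1))}$; $\tau(F)=\lim_{n\to\infty}d_n(F)$ (the limit exists), with $\tau(F)=0$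 if $F$ is finite or empty. (It coincides with the logarithmic capacity and the Chebyshev constant.) *)

(* Defs.v *)
From HB Require Import structures.
From mathcomp Require Import all_boot all_order all_algebra.
From mathcomp Require Import all_classical all_reals all_analysis.
From mathcomp Require Import complex.
Set Implicit Arguments. Unset Strict Implicit. Unset Printing Implicit Defensive.
Import Order.TTheory GRing.Theory Num.Theory.
Import numFieldNormedType.Exports.
Local Open Scope classical_set_scope.
Local Open Scope ring_scope.

(* topology on C = R[i] induced by its norm (as a numClosedFieldType) *)
HB.instance Definition _ (R : realType) := PseudoPointedMetric.copy R[i] (R[i])^o.

Section Defs.
Variable R : realType.

Definition Lambda : set R := `[(- pi), pi]%classic.

Definition expi (x : R) : R[i] := (cos x +i* sin x)%C.

Definition spectral_density (f : R -> R) : Prop :=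
  [/\ (forall x, Lambda x -> 0 <= f x),
      (lebesgue_measure).-integrable Lambda (EFin \o f) &
      (0 < lebesgue_measure (Lambda `&` [set x | (0 < f x)%R]))%E].

Definition pred_err2 (n : nat) (f : R -> R) : R :=
  inf (range (fun c : 'I_n -> R[i] =>
    Rintegral lebesgue_measure Lambda
      (fun l => Normc.normc (1 - \sum_(k < n) c k * expi (- ((k.+1)%:R * l))) ^+ 2
                * f l))).

Definition pred_err (n : nat) (f : R -> R) : R := Num.sqrt (pred_err2 n f).

Definition spectrum (f : R -> R) : set R[i] :=
  [set expi l | l in Lambda `&` [set l | 0 < f l]].

Definition closed_arc (a b : R) : set R[i] := [set expi t | t in `[a, b]%classic].

Definition diam_n (n : nat) (F : set R[i]) : R :=
  sup [set (\prod_(j < n) \prod_(k < n | (j < k)%N) Normc.normc (z j - z k))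
             `^ (2 / (n * (n - 1))%:R)
      | z in [set z : 'I_n -> R[i] | forall i, F (z i)]].

Definition transfinite_diameter (F : set R[i]) : R :=
  if pselect (finite_set F) then 0 else limn (fun n => diam_n n.+2 F).

End Defs.

(* Main.v *)
Require Import Defs.
From HB Require Import structures.
From mathcomp Require Import all_boot all_order all_algebra.
From mathcomp Require Import all_classical all_reals all_analysis.
From mathcomp Require Import complex.
From mathcomp Require Import perm measurable_realfun ring lra zify.
Import Order.TTheory GRing.Theory Num.Theory.
Import numFieldNormedType.Exports.
Local Open Scope classical_set_scope.
Local Open Scope ring_scope.

(** Write [V n] for the supremum of the Vandermonde products
    [prod_(j < k) |z_j - z_k|] of [n] points of the spectrum [E], so that the
    [n]-th diameter is [V n ^ (2 / (n (n - 1)))].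

    Upper bound. A monic polynomial with nearly optimal nodes is at most
    [2 V (n+1) / V n] on [E], and [V (n+1) / V n <= diam_n ^ n].

    Lower bound. Suppose that a monic [P] of degree [n] has weighted L2 norm
    below [r ^ n] with [r < tau]. By Markov's inequality [|P| <= K r ^ n] on [E]
    outside a set of small measure, [K] being independent of [n]. Any [n + m]
    points of [E] can be moved into the remaining good set while every distance
    shrinks at most by a factor close to 1: collapse the bad set and stretch the
    arcs back to their original length. At good points, the Vandermonde
    determinant can be evaluated with near-optimal monic polynomials of degree
    [< n] and with [P, X P, ..., X^(m-1) P] as rows, and therefore
    [V (n+m) <= C^((n+m)^2) (n+m)! 2^n (V n) (K r^n)^m] with [C] close to 1.
    Since [V k] is [tau ^ (k^2 / 2)] up to [exp (o(k^2))], taking [m] to be a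
    small fraction of [n] contradicts [r < tau]. *)

Set Implicit Arguments.
Unset Strict Implicit.
Unset Printing Implicit Defensive.

Import Normc.

(** * Vandermonde products *)

Section Vdm.
Variable R : realType.
Local Notation C := R[i].
Implicit Types (z w : R[i]).

Lemma normc_ge0 z : 0 <= normc z.
Proof. by case: z => a b; apply: sqrtr_ge0. Qed.

Lemma normc_sum (I : Type) (r : seq I) (P : pred I) (F : I -> R[i]) :
  normc (\sum_(i <- r | P i) F i) <= \sum_(i <- r | P i) normc (F i).
Proof.
elim/big_ind2 : _ => [|x1 x2 y1 y2 h1 h2|//]; first by rewrite normc0.
exact: le_trans (le_normcD _ _) (lerD h1 h2).
Qed.

Lemma normc_prod (I : Type) (r : seq I) (P : pred I) (F : I -> R[i]) :
  normc (\prod_(i <- r | P i) F i) = \prod_(i <- r | P i) normc (F i).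
Proof. by apply: (big_morph _ (@normcM _)); rewrite normc1. Qed.

Lemma normcX z n : normc (z ^+ n) = normc z ^+ n.
Proof. by elim: n => [|n IH]; rewrite ?expr0 ?normc1 // !exprS normcM IH. Qed.

Definition vdm n (z : 'I_n -> R[i]) : R :=
  \prod_(j < n) \prod_(k < n | (j < k)%N) normc (z j - z k).

Lemma vdm_ge0 n (z : 'I_n -> R[i]) : 0 <= vdm z.
Proof. by apply: prodr_ge0 => j _; apply: prodr_ge0 => k _; apply: normc_ge0. Qed.

(** The Leibniz expansion has n! terms, and each is a product of one entry from every row; the bound
    [M i] is uniform along row [i]. *)
Lemma normc_det_le n (A : 'M[C]_n) (M : 'I_n -> R) :
  (forall i j, normc (A i j) <= M i) ->
  normc (\det A) <= n`!%:R * \prod_i M i.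
Proof.
move=> AM; rewrite /determinant.
apply: le_trans (normc_sum _ _ _) _.
have -> : n`!%:R * \prod_i M i = \sum_(s : 'S_n) \prod_i M i.
  by rewrite sumr_const card_Sn mulr_natl.
apply: ler_sum => s _; rewrite normcM normcX normcN normc1 expr1n mul1r.
rewrite normc_prod; apply: ler_prod => i _; by rewrite normc_ge0 AM.
Qed.

Lemma vdm_det n (z : 'I_n -> R[i]) :
  vdm z = normc (\det (Vandermonde n (\row_j z j))).
Proof.
rewrite det_Vandermonde normc_prod; apply: eq_bigr => j _.
rewrite normc_prod; apply: eq_bigr => k _.
by rewrite !mxE -normcN opprB.
Qed.

(* Replacing the monomials by monic polynomials of the same degrees multiplies
   the Vandermonde matrix by a unitriangular one. *)
Lemma vdm_le_monic n (z : 'I_n -> R[i]) (P : 'I_n -> {poly C}) (M : 'I_n -> R) :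
  (forall k, P k \is monic) -> (forall k, size (P k) = k.+1) ->
  (forall k j, normc (P k).[z j] <= M k) ->
  vdm z <= n`!%:R * \prod_k M k.
Proof.
move=> Pm sP PM.
pose T := \matrix_(k < n, i < n) (P k)`_i.
pose B := \matrix_(k < n, j < n) (P k).[z j].
have BE : B = T *m Vandermonde n (\row_j z j).
  apply/matrixP => k j; rewrite !mxE (@horner_coef_wide _ n) ?sP ?ltn_ord //.
  by apply: eq_bigr => i _; rewrite !mxE.
have dT : \det T = 1.
  rewrite det_trig.
    rewrite big1 // => k _; rewrite mxE.
    by move/eqP: (Pm k); rewrite lead_coefE sP.
  apply/is_trig_mxP => k i ki; rewrite mxE nth_default // sP; exact: ki.
rewrite vdm_det -[X in normc X]mul1r -dT -det_mulmx -BE.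
by apply: normc_det_le => i j; rewrite mxE.
Qed.

Definition vdrop n (z : 'I_n.+1 -> R[i]) (i : 'I_n.+1) : 'I_n -> R[i] :=
  fun j => z (lift i j).

Definition vcons n (w : R[i]) (z : 'I_n -> R[i]) : 'I_n.+1 -> R[i] :=
  fun i => if unlift ord0 i is Some j then z j else w.

Lemma vdm_cons n (w : R[i]) (z : 'I_n -> R[i]) :
  vdm (vcons w z) = (\prod_j normc (w - z j)) * vdm z.
Proof.
rewrite /vdm big_ord_recl; congr (_ * _).
  rewrite big_mkcond big_ord_recl /= mul1r; apply: eq_bigr => j _ /=.
  by rewrite /vcons unlift_none liftK.
apply: eq_bigr => j _; rewrite big_mkcond big_ord_recl /= mul1r.
rewrite [RHS]big_mkcond; apply: eq_bigr => k _ /=.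
by rewrite /vcons !liftK.
Qed.

(* Each pair survives in all but two of the [n.+2] deletions. *)
Lemma vdm_drop n (z : 'I_n.+2 -> R[i]) :
  \prod_i vdm (vdrop z i) = vdm z ^+ n.
Proof.
(* Padding with 1 off the pairs [j < k] lets all products run over full index sets, so that their
   order can be exchanged. *)
pose F (j k : 'I_n.+2) := if (j < k)%N then normc (z j - z k) else 1.
have vE : vdm z = \prod_j \prod_k F j k.
  by rewrite /vdm; apply: eq_bigr => j _; rewrite big_mkcond.
have dE i : vdm (vdrop z i) = \prod_(j | j != i) \prod_(k | k != i) F j k.
  rewrite /vdm.
  have reidx (G : 'I_n.+2 -> R) :
      \prod_(j | j != i) G j = \prod_j G (lift i j).
    rewrite big_mkcond (bigD1_ord i) //= eqxx mul1r.
    by apply: eq_bigr => j _; rewrite eq_sym neq_lift.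
  rewrite reidx; apply: eq_bigr => j _; rewrite reidx big_mkcond.
  apply: eq_bigr => k _; rewrite /F /vdrop /= /bump.
  (* Skipping the index [i] preserves the order of the remaining indices. *)
  by have -> : ((i <= j) + j < (i <= k) + k)%N = (j < k)%N by lia.
under eq_bigr do rewrite dE big_mkcond.
rewrite exchange_big vE /= -prodrXl; apply: eq_bigr => j _.
under eq_bigr do rewrite -(fun_if (fun x => x)) /=.
transitivity (\prod_i \prod_k if (j != i) && (k != i) then F j k else 1).
  apply: eq_bigr => i _; case: (j != i) => /=; first by rewrite big_mkcond.
  by rewrite big1.
rewrite exchange_big -prodrXl; apply: eq_bigr => k _ /=.
rewrite -big_mkcond prodr_const.
have [->|jk] := eqVneq j k; first by rewrite /F ltnn !expr1n.
have := cardsC [set j; k]%SET; rewrite cards2 jk card_ord => -[cn].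
congr (_ ^+ _); rewrite -[RHS]cn; apply: eq_card => i.
by rewrite !inE negb_or !(eq_sym i).
Qed.
End Vdm.

(** * Diameters of an infinite subset of the circle *)

Section MaxVdm.
Variables (R : realType) (E : set R[i]).
Local Notation C := R[i].
Hypothesis E1 : forall z, E z -> normc z = 1.
Hypothesis Einf : infinite_set E.

Definition maxvdm n : R :=
  sup [set vdm z | z in [set z : 'I_n -> R[i] | forall i, E (z i)]].

Lemma infinite_inj n : exists2 z : 'I_n -> C, injective z & forall i, E (z i).
Proof.
have /infiniteP/pcard_leP[f] := Einf.
exists (fun i : 'I_n => f (nat_of_ord i)); last by move=> i; apply: funS.
by move=> i j /(inj (mem_set I) (mem_set I)) /ord_inj.
Qed.

(** Chords of the unit circle have length at most 2; this makes the supremum [maxvdm] a genuine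
    one. *)
Lemma vdm_le2 n (z : 'I_n -> C) : (forall i, E (z i)) ->
  vdm z <= \prod_(j < n) \prod_(k < n | (j < k)%N) 2.
Proof.
move=> Ez; apply: ler_prod => j _; rewrite prodr_ge0 => [|k _]; last exact: normc_ge0.
apply: ler_prod => k _; rewrite normc_ge0 /=.
by apply: le_trans (le_normcD _ _) _; rewrite normcN !E1.
Qed.

Lemma has_sup_vdm n :
  has_sup [set vdm z | z in [set z : 'I_n -> R[i] | forall i, E (z i)]].
Proof.
split; first by have [z _ Ez] := infinite_inj n; exists (vdm z), z.
by exists (\prod_(j < n) \prod_(k < n | (j < k)%N) 2) => _ [z Ez <-]; apply: vdm_le2.
Qed.

Lemma vdm_le_max n (z : 'I_n -> C) : (forall i, E (z i)) -> vdm z <= maxvdm n.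
Proof. by move=> Ez; apply: ub_le_sup; [case: (has_sup_vdm n)|exists z]. Qed.

Lemma maxvdm_le n M : (forall z : 'I_n -> C, (forall i, E (z i)) -> vdm z <= M) ->
  maxvdm n <= M.
Proof.
move=> EM; apply: ge_sup; first by case: (has_sup_vdm n).
by move=> _ [z Ez <-]; apply: EM.
Qed.

Lemma maxvdm_gt0 n : 0 < maxvdm n.
Proof.
have [z zi Ez] := infinite_inj n.
apply: lt_le_trans (vdm_le_max Ez); apply: prodr_gt0 => j _.
apply: prodr_gt0 => k jk; rewrite lt_neqAle normc_ge0 andbT eq_sym.
apply/eqP => /eq0_normc/eqP; rewrite subr_eq0 => /eqP/zi jk'.
by rewrite jk' ltnn in jk.
Qed.

(** Fekete's argument: each of the [n.+2] deletions of a point leaves a product of at most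
    [maxvdm n.+1], their product is [vdm z ^+ n], and the [n]-th root is taken. *)
Lemma maxvdm_step n : (0 < n)%N ->
  maxvdm n.+2 <= maxvdm n.+1 `^ (n.+2%:R / n%:R).
Proof.
move=> n0; apply: maxvdm_le => z Ez.
have nR : n%:R != 0 :> R by rewrite pnatr_eq0 -lt0n.
have -> : vdm z = (vdm z ^+ n) `^ n%:R^-1.
  by rewrite -powR_mulrn ?vdm_ge0 // -powRrM divff // powRr1 // vdm_ge0.
rewrite powRrM; apply: ge0_ler_powR; rewrite ?nnegrE ?invr_ge0 ?exprn_ge0 ?vdm_ge0 ?powR_ge0 //.
rewrite powR_mulrn ?(ltW (maxvdm_gt0 _)) // -vdm_drop.
have -> : maxvdm n.+1 ^+ n.+2 = \prod_(i < n.+2) maxvdm n.+1.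
  by rewrite prodr_const card_ord.
by apply: ler_prod => i _; rewrite vdm_ge0 vdm_le_max // => j; apply: Ez.
Qed.

Lemma diam_maxvdm n : (1 < n)%N ->
  diam_n n E = maxvdm n `^ (2 / (n * (n - 1))%:R).
Proof.
move=> n1; set e := 2 / _.
have e0 : 0 < e by rewrite divr_gt0 // ltr0n; nia.
have ne : [set vdm z `^ e | z in [set z : 'I_n -> C | forall i, E (z i)]] !=set0.
  by have [z _ Ez] := infinite_inj n; exists (vdm z `^ e), z.
have ub (z : 'I_n -> C) : (forall i, E (z i)) -> vdm z `^ e <= maxvdm n `^ e :> R.
  move=> Ez; apply: ge0_ler_powR; rewrite ?nnegrE ?vdm_ge0 ?(ltW (maxvdm_gt0 _)) ?(ltW e0) //.
  exact: vdm_le_max.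
apply/le_anti/andP; split.
  by apply: ge_sup => // _ [z Ez <-]; apply: ub.
have ub' (z : 'I_n -> C) : (forall i, E (z i)) -> vdm z `^ e <= diam_n n E :> R.
  move=> Ez; apply: ub_le_sup; last by exists z.
  by exists (maxvdm n `^ e) => _ [w Ew <-]; apply: ub.
have d0 : 0 <= diam_n n E.
  by have [z _ Ez] := infinite_inj n; apply: le_trans (ub' z Ez); apply: powR_ge0.
have -> : diam_n n E = (diam_n n E `^ e^-1) `^ e.
  by rewrite -powRrM mulVf ?gt_eqF // powRr1.
apply: ge0_ler_powR; rewrite ?nnegrE ?powR_ge0 ?(ltW (maxvdm_gt0 _)) ?(ltW e0) //.
apply: maxvdm_le => z Ez.
have -> : vdm z = (vdm z `^ e) `^ e^-1.
  by rewrite -powRrM divff ?gt_eqF // powRr1 // vdm_ge0.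
by apply: ge0_ler_powR; rewrite ?nnegrE ?powR_ge0 ?invr_ge0 ?(ltW e0) // ub'.
Qed.

Lemma diam_gt0 n : (1 < n)%N -> 0 < diam_n n E.
Proof. by move=> n1; rewrite diam_maxvdm // powR_gt0 // maxvdm_gt0. Qed.

Lemma ln_maxvdm n : (1 < n)%N ->
  ln (maxvdm n) = (n%:R * (n%:R - 1) / 2) * ln (diam_n n E).
Proof.
move=> n1; rewrite diam_maxvdm // ln_powR mulrA natrM natrB; last exact: ltnW.
have h1 : n%:R != 0 :> R by rewrite pnatr_eq0; lia.
have h2 : n%:R - 1 != 0 :> R by rewrite subr_eq0 pnatr_eq1; lia.
by field; rewrite h1 h2.
Qed.

(** The step inequality is exactly what is needed: after renaming, [(n+3)/(n+1)] times
    [2/((n+3)(n+2))] is [2/((n+2)(n+1))]. *)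
Lemma diam_decr n : (1 < n)%N -> diam_n n.+1 E <= diam_n n E.
Proof.
case: n => // -[//|n] _; rewrite !diam_maxvdm //.
apply: (@le_trans _ _ ((maxvdm n.+2 `^ (n.+3%:R / n.+1%:R)) `^ (2 / (n.+3 * (n.+3 - 1))%:R))).
  apply: ge0_ler_powR; rewrite ?nnegrE ?powR_ge0 ?(ltW (maxvdm_gt0 _)) ?divr_ge0 //.
  exact: maxvdm_step.
rewrite -powRrM; rewrite le_eqVlt; apply/orP; left; apply/eqP; congr (_ `^ _).
rewrite !subn1 /= !natrM.
have n0 : 0 <= n%:R :> R by [].
by field; do ?[apply/andP; split]; apply: lt0r_neq0; lra.
Qed.

(** By the step inequality the ratio is at most [maxvdm n] to the power [(n+1)/(n-1) - 1 = 2/(n-1)],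
    which is [n] times the exponent in [diam_n]. *)
Lemma maxvdm_ratio n : (1 < n)%N -> maxvdm n.+1 / maxvdm n <= diam_n n E ^+ n.
Proof.
case: n => // -[//|n] _; rewrite ler_pdivrMr ?maxvdm_gt0 //.
apply: le_trans (maxvdm_step (ltn0Sn n)) _.
rewrite diam_maxvdm // -powR_mulrn ?powR_ge0 // -powRrM.
rewrite -[X in _ <= _ * X]powRr1 ?(ltW (maxvdm_gt0 _)) // -powRD; last first.
  by rewrite (gt_eqF (maxvdm_gt0 _)) implybT.
rewrite le_eqVlt; apply/orP; left; apply/eqP; congr (_ `^ _); rewrite subn1 /= natrM.
have -> : n.+3%:R = n.+1%:R + 2 :> R by rewrite -natrD; congr _%:R; lia.
have n0 : 0 <= n%:R :> R by [].
by field; do ?[apply/andP; split]; apply: lt0r_neq0; lra.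
Qed.

Lemma diam_nonincreasing :
  {homo (fun n => diam_n n.+2 E) : m n / (m <= n)%N >-> n <= m}.
Proof. by apply/nonincreasing_seqP => n; apply: diam_decr. Qed.

Lemma diam_has_lbound : has_lbound (range (fun n => diam_n n.+2 E)).
Proof. by exists 0 => _ [n _ <-]; apply/ltW/diam_gt0. Qed.

Lemma transfinite_diameterE :
  transfinite_diameter E = limn (fun n => diam_n n.+2 E).
Proof. by rewrite /transfinite_diameter; case: pselect. Qed.

Lemma diam_cvg : (fun n => diam_n n E) @ \oo --> transfinite_diameter E.
Proof.
rewrite transfinite_diameterE -(cvg_shiftn 2).
under eq_fun do rewrite addn2.
apply: nonincreasing_is_cvgn; [exact: diam_nonincreasing|exact: diam_has_lbound].
Qed.

Lemma transfinite_diameter_le n : (1 < n)%N -> transfinite_diameter E <= diam_n n E.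
Proof.
case: n => // -[//|n] _; rewrite transfinite_diameterE.
apply: (nonincreasing_cvgn_ge diam_nonincreasing).
by apply: nonincreasing_is_cvgn; [exact: diam_nonincreasing|exact: diam_has_lbound].
Qed.

(* A near-optimal [n]-tuple of points works: the factor 2 absorbs the possible
   non-attainment of the supremum. *)
Lemma exists_small_monic n : exists P : {poly C},
  [/\ P \is monic, size P = n.+1 &
   forall w, E w -> normc P.[w] <= 2 * (maxvdm n.+1 / maxvdm n)].
Proof.
have [|_ [z Ez <-] zV] := sup_gt (x := maxvdm n / 2) (has_sup_vdm n).1.
  by rewrite ltr_pdivrMr // ltr_pMr ?maxvdm_gt0 // ltr1n.
exists (\prod_(j < n) ('X - (z j)%:P)); split.
- exact: monic_prod_XsubC.
- by rewrite size_prod_XsubC /index_enum -enumT size_enum_ord.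
move=> w Ew; rewrite horner_prod normc_prod.
under eq_bigr do rewrite !hornerE.
have v0 : 0 < vdm z by apply: lt_trans zV; rewrite divr_gt0 // maxvdm_gt0.
(* Adjoining [w] to the nodes gives an admissible tuple of [n.+1] points. *)
have h : (\prod_j normc (w - z j)) * vdm z <= maxvdm n.+1.
  rewrite -vdm_cons; apply: vdm_le_max => i; rewrite /vcons.
  by case: unlift => [j|].
rewrite mulrA ler_pdivlMr ?maxvdm_gt0 //.
rewrite ltr_pdivrMr // in zV.
apply: le_trans (ler_wpM2l _ (ltW zV)) _; last by lra.
by apply: prodr_ge0 => j _; apply: normc_ge0.
Qed.

End MaxVdm.

(** * Chords of the circle *)

Section Chord.
Variable R : realType.
Implicit Types (x y a b c t u v : R).

Lemma normc_expi x : normc (expi x) = 1.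
Proof. by rewrite /normc /= cos2Dsin2 sqrtr1. Qed.

Lemma expiD x y : expi (x + y) = expi x * expi y.
Proof. by rewrite /expi cosD sinD; simpc; rewrite addrC (mulrC (sin x)) (addrC (cos x * sin y)). Qed.

Lemma expiMn x n : expi (n%:R * x) = expi x ^+ n.
Proof.
elim: n => [|n IH]; first by rewrite mul0r /expi cos0 sin0.
by rewrite exprS -natr1 mulrDl mul1r addrC expiD IH.
Qed.

Lemma expi_per x (n : nat) : expi (x + (2 * pi) * n%:R) = expi x.
Proof.
rewrite mulrC expiD expiMn.
have -> : expi (2 * pi : R) = 1.
  by rewrite /expi mulrC mulr_natr cos2pi sin2pi.
by rewrite expr1n mulr1.
Qed.

Lemma expi_rep a x : exists2 y, a <= y < a + 2 * pi & expi y = expi x.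
Proof.
have p0 : 0 < 2 * pi :> R by rewrite mulr_gt0 // pi_gt0.
pose k := Num.floor ((x - a) / (2 * pi)).
have /andP[k1 k2] := floor_itv ((x - a) / (2 * pi)); rewrite -/k in k1 k2.
exists (x - (2 * pi) * k%:~R).
  rewrite ler_pdivlMr // in k1; rewrite intrD ltr_pdivrMr // mulrDl mul1r in k2.
  by apply/andP; split; lra.
case: k {k1 k2} => n; last by rewrite NegzE mulrN opprK expi_per.
by rewrite -[LHS](expi_per _ n) subrK.
Qed.

Lemma chord x y : normc (expi x - expi y) = 2 * `|sin ((x - y) / 2)|.
Proof.
set v := (x - y) / 2; set u := (x + y) / 2.
have -> : x = u + v by rewrite /u /v; lra.
have -> : y = u - v by rewrite /u /v; lra.
move: u v => u v.
rewrite /expi /normc; simpc; rewrite /= cosB sinB cosD sinD.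
set q := _ + _; have -> : q = (2 * sin v) ^+ 2.
  rewrite /q; transitivity (4 * (sin v) ^+ 2 * (cos u ^+ 2 + sin u ^+ 2)); first by ring.
  by rewrite cos2Dsin2; ring.
by rewrite sqrtr_sqr normrM ger0_norm.
Qed.

Lemma ge_cos x y : 0 <= x -> x <= y -> y <= pi -> cos y <= cos x.
Proof.
move=> x0 xy yp; rewrite leNgt ltr_cos ?in_itv /=; last 2 first.
- by rewrite (le_trans x0 xy).
- by rewrite x0 (le_trans xy).
by rewrite -leNgt.
Qed.

Lemma le_sin x y : 0 <= x -> x <= y -> y <= pi / 2 -> sin x <= sin y.
Proof.
have := pi_gt0 R => p0.
move=> x0 xy yp; rewrite leNgt ltr_sin ?in_itv /=; last 2 first.
- by apply/andP; split; lra.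
- by apply/andP; split; lra.
by rewrite -leNgt.
Qed.

(** The difference [c sin t - sin (c t)] vanishes at 0 and has derivative [c (cos t - cos (c t))],
    which is nonnegative because cosine decreases on [[0, pi]]. *)
Lemma sin_dilate c x : 1 <= c -> 0 <= x -> c * x <= pi / 2 ->
  sin (c * x) <= c * sin x.
Proof.
move=> c1 x0 cx; have p0 := pi_gt0 R.
pose g t := c * sin t - sin (c * t).
have dc t : is_derive t 1 (fun t => c * t) c.
  apply: (@is_derive_eq _ _ _ _ _ _ _ _ (@is_deriveZ _ _ _ id c t 1 1 _)).
  by rewrite scaler1.
have dg t : is_derive t 1 g (c * cos t - cos (c * t) * c).
  have h1 : is_derive t 1 (fun t => c * sin t) (c * cos t).
    exact: (@is_deriveZ _ _ _ (@sin R)).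
  exact: (is_deriveB h1 (is_derive1_comp (is_derive_sin (c * t)) (dc t))).
suff : g 0 <= g x by rewrite /g mulr0 sin0 mulr0 subrr subr_ge0.
apply: (@ger0_derive1_le_cc _ g 0 x); rewrite ?in_itv /= ?lexx ?x0 //.
- by move=> t; rewrite in_itv /= => /andP[t0 tx]; rewrite derive1E derive_val [X in _ - X]mulrC -mulrBr
    mulr_ge0 ?subr_ge0 ?ge_cos //; nra.
- apply: continuous_subspaceT => t; apply: differentiable_continuous.
  by apply/derivable1_diffP.
Qed.

Lemma sin_contract_half c u v : 1 <= c -> 0 <= u <= pi / 2 -> 0 <= v <= c * u ->
  sin v <= c * sin u.
Proof.
move=> c1 /andP[u0 up] /andP[v0 vcu].
have p0 := pi_gt0 R.
have [cup|cup] := leP (c * u) (pi / 2).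
  by apply: le_trans (le_sin v0 vcu cup) _; apply: sin_dilate.
apply: (le_trans (sin_le1 _)).
have c0 : 0 < c by lra.
(* Past this point [c * sin u] is already at least 1. *)
pose u0' := pi / 2 / c.
have cu0 : c * u0' = pi / 2 by rewrite /u0'; field; rewrite gt_eqF.
have h0 : 0 <= u0' by rewrite /u0' !divr_ge0 // ltW.
have h1 : u0' <= u by rewrite /u0' ler_pdivrMr // [u * c]mulrC ltW.
apply: (@le_trans _ _ (c * sin u0')); last by rewrite ler_pM2l // le_sin.
by rewrite -(sin_pihalf R) -cu0; apply: sin_dilate; rewrite // cu0.
Qed.

(* [2 u] and [2 v] are the lengths of two arcs: the second arc is at most [c]
   times the first one, and so is its complement. *)
Lemma sin_contract c u v : 1 <= c -> 0 <= u <= pi -> 0 <= v <= pi ->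
  v <= c * u -> pi - v <= c * (pi - u) -> sin v <= c * sin u.
Proof.
move=> c1 /andP[u0 up] /andP[v0 vp] h1 h2.
have [uh|uh] := leP u (pi / 2).
  by apply: sin_contract_half => //; apply/andP.
have sinpB (w : R) : sin (pi - w) = sin w by rewrite sinB sinpi cospi; ring.
by rewrite -(sinpB u) -(sinpB v); apply: sin_contract_half => //; apply/andP; split; lra.
Qed.

(** Two points cut the circle into two arcs. The Lipschitz bound controls the arc between them;
    since the ends of the period are fixed, adding the bounds on the two outer pieces controls the
    other one. [sin_contract] then compares the chords. *)
Lemma chord_contract c a (phi : R -> R) : 1 <= c ->
  phi a = a -> phi (a + 2 * pi) = a + 2 * pi ->
  (forall x y, a <= x -> x <= y -> y <= a + 2 * pi ->
     phi x <= phi y /\ phi y - phi x <= c * (y - x)) ->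
  forall x y, a <= x <= a + 2 * pi -> a <= y <= a + 2 * pi ->
  normc (expi (phi x) - expi (phi y)) <= c * normc (expi x - expi y).
Proof.
move=> c1 pa pb lip.
suff wl x y : a <= x -> x <= y -> y <= a + 2 * pi ->
    normc (expi (phi y) - expi (phi x)) <= c * normc (expi y - expi x).
  move=> x y /andP[ax xb] /andP[ay yb].
  have [xy|/ltW yx] := leP x y; last exact: wl.
  by rewrite -normcN -[X in _ <= _ * X]normcN !opprB; apply: wl.
move=> ax xy yb.
have [m1 l1] := lip _ _ ax xy yb.
have [m2 l2] := lip _ _ (lexx a) ax (le_trans xy yb).
have [m3 l3] := lip _ _ (le_trans ax xy) yb (lexx _).
rewrite pa in m2 l2; rewrite pb in m3 l3.
rewrite !chord mulrCA ler_pM2l // !ger0_norm; last 2 first.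
- by apply: sin_ge0_pi; apply/andP; split; lra.
- by apply: sin_ge0_pi; apply/andP; split; lra.
by apply: sin_contract => //; [apply/andP; split; lra| apply/andP; split; lra|lra|lra].
Qed.

End Chord.

(** * Pulling points of an arc into a compact subset *)

Section Pull.
Variable R : realType.
Local Notation mu := (@lebesgue_measure R).
Variables (a b : R) (A : set R).
Hypotheses (ab : a < b) (Aab : A `<=` `[a, b]) (Ac : compact A).

(** The distribution function of Lebesgue measure restricted to [A]: it is constant across the gaps
    of [A]. *)
Definition amass (x : R) : R := fine (mu (A `&` `]-oo, x])).

Let mA : measurable A.
Proof. by apply: compact_measurable. Qed.

Let fin_sub (B : set R) : measurable B -> B `<=` `[a, b] -> (mu B < +oo)%E.
Proof.
move=> mB Bab; apply: (@le_lt_trans _ _ (mu `[a, b])).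
  by apply: le_measure; rewrite ?inE.
by rewrite lebesgue_measure_itv /= lte_fin ab -EFinB ltry.
Qed.

Let fin_A (B : set R) : measurable B -> mu (A `&` B) \is a fin_num.
Proof.
move=> mB; rewrite ge0_fin_numE //; apply: fin_sub; first exact: measurableI.
by move=> x [/Aab].
Qed.

Let amassB x y : x <= y -> amass y - amass x = fine (mu (A `&` `]x, y])).
Proof.
move=> xy; rewrite /amass.
have -> : A `&` `]-oo, y] = (A `&` `]-oo, x]) `|` (A `&` `]x, y]).
  rewrite -setIUr -itv_bndbnd_setU //.
rewrite measureU; last 3 first.
- exact: measurableI.
- exact: measurableI.
- rewrite -subset0 => z [[_ /=]]; rewrite !in_itv /= => zx [_] /=.
  by rewrite ltNge zx.
by rewrite fineD ?fin_A // addrAC subrr add0r.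
Qed.

Lemma amass_mono x y : x <= y -> amass x <= amass y.
Proof. by move=> xy; rewrite -subr_ge0 amassB // fine_ge0. Qed.

Lemma amass_lip x y : x <= y -> amass y - amass x <= y - x.
Proof.
move=> xy; rewrite amassB // -lee_fin fineK ?fin_A //.
apply: (@le_trans _ _ (mu `]x, y])); first by apply: le_measure; rewrite ?inE //; exact: measurableI.
by rewrite lebesgue_measure_itv /= lte_fin; case: ltP => // _; rewrite lee_fin subr_ge0.
Qed.

Lemma amass_flat x y : x <= y -> A `&` `]x, y] `<=` [set y] -> amass y = amass x.
Proof.
move=> xy Axy; apply/eqP; rewrite -subr_eq0 amassB //.
have -> : mu (A `&` `]x, y]) = 0%E; last by [].
apply/le_anti/andP; split => //; rewrite -(lebesgue_measure_set1 y).
by apply: le_measure; rewrite ?inE //; exact: measurableI.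
Qed.

Lemma amass_left : amass a = 0.
Proof.
rewrite /amass (_ : mu _ = 0%E) //.
apply/le_anti/andP; split => //; rewrite -(lebesgue_measure_set1 a).
apply: le_measure; rewrite ?inE //; first exact: measurableI.
move=> x [/Aab /=]; rewrite !in_itv /= => /andP[ax _] xa.
by apply/le_anti/andP.
Qed.

Lemma amass_right x : b <= x -> amass x = fine (mu A).
Proof.
move=> bx; rewrite /amass; congr (fine (mu _)); apply/setIidl => y /Aab /=.
by rewrite !in_itv /= => /andP[_ yb]; apply: le_trans bx.
Qed.

Lemma amass_continuous : continuous amass.
Proof.
move=> x; apply/cvgrPdist_le => e e0; near=> y.
have xy : `|x - y| <= e.
  near: y; apply: cvgr_dist_le => //; exact: cvg_id.
apply: le_trans xy; have [xy|/ltW xy] := leP x y.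
  rewrite distrC [leRHS]distrC !ger0_norm ?subr_ge0 ?amass_mono //.
  exact: amass_lip.
by rewrite !ger0_norm ?subr_ge0 ?amass_mono // amass_lip.
Unshelve. all: by end_near. Qed.

(** The intermediate value theorem gives a point [x0] of the interval, perhaps in a gap of [A]. It
    is replaced by the first point of [A] to its right or, if there is none, by the last point of
    [A]; [amass] does not change in between. *)
Lemma amass_onto v : 0 <= v <= fine (mu A) -> A !=set0 -> exists2 x, A x & amass x = v.
Proof.
move=> /andP[v0 vl] A0.
have [|x0] := @IVT _ amass a b v (ltW ab) (continuous_subspaceT amass_continuous).
  rewrite amass_left amass_right // min_l ?max_r ?v0 //; exact: fine_ge0.
rewrite in_itv /= => /andP[ax0 x0b] <-.
have [[z [Az zx]]|none] := pselect (A `&` `[x0, b] !=set0).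
  have cS : compact (A `&` `[x0, b]) by apply: compact_closedI => //; exact: interval_closed.
  have [//||x xS xmin] := @compact_EVT_min _ _ idfun (A `&` `[x0, b]) _ cS.
  - by exists z.
  - by apply: continuous_subspaceT => ?; exact: cvg_id.
  move: xS; rewrite inE => -[Ax] /=; rewrite in_itv /= => /andP[x0x xb].
  exists x => //; apply: amass_flat => // y [Ay] /=; rewrite in_itv /= => /andP[x0y yx].
  apply/le_anti; rewrite yx /=; apply: xmin; rewrite inE; split => //=.
  by rewrite in_itv /= (ltW x0y) (le_trans yx).
have [|x] := @compact_EVT_max _ _ idfun A A0 Ac.
  by apply: continuous_subspaceT => ?; exact: cvg_id.
rewrite inE => Ax xmax; exists x => //.
have := Aab Ax; rewrite /= in_itv /= => /andP[ax xb].
have <- : amass b = amass x0.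
  apply: amass_flat => // y [Ay] /=; rewrite in_itv /= => /andP[x0y yb].
  by case: none; exists y; split => //=; rewrite in_itv /= yb ltW.
symmetry; apply: amass_flat => // y [Ay] /=; rewrite in_itv /= => /andP[xy _].
by have := xmax y; rewrite inE => /(_ Ay); rewrite leNgt xy.
Qed.

Hypotheses (b2pi : b <= a + 2 * pi) (muA : 0 < fine (mu A)).

Lemma fine_mu_le : fine (mu A) <= b - a.
Proof. by rewrite -(amass_right (lexx b)) -(subr0 (amass b)) -amass_left amass_lip // ltW. Qed.

Let c := (b - a) / fine (mu A).

Let c1 : 1 <= c.
Proof. by rewrite /c ler_pdivlMr // mul1r fine_mu_le. Qed.

(** At [b] the first two summands add up to [b]; the last one then continues the map as the
    identity. *)
Definition squash (x : R) : R := a + c * amass x + Num.max 0 (x - b).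

Lemma squash_left : squash a = a.
Proof. by rewrite /squash amass_left mulr0 addr0 max_l ?addr0 // subr_le0 ltW. Qed.

Lemma squash_out x : b <= x -> squash x = x.
Proof.
move=> bx; rewrite /squash amass_right // max_r ?subr_ge0 //.
rewrite /c mulfVK ?gt_eqF //; lra.
Qed.

Lemma squash_lip x y : x <= y ->
  squash x <= squash y /\ squash y - squash x <= c * (y - x).
Proof.
move=> xy; have c0 : 0 <= c by rewrite (le_trans _ c1).
have inc u v : u <= v -> v <= b -> squash u <= squash v /\ squash v - squash u <= c * (v - u).
  move=> uv vb; rewrite /squash !max_l ?subr_le0 ?(le_trans uv) //.
  have h1 := ler_wpM2l c0 (amass_mono uv); have h2 := ler_wpM2l c0 (amass_lip uv).
  by rewrite mulrBr in h2; split; lra.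
have out u v : b <= u -> u <= v -> squash u <= squash v /\ squash v - squash u <= c * (v - u).
  move=> bu uv; rewrite !squash_out ?(le_trans bu) //; split => //.
  by rewrite ler_peMl // subr_ge0.
have [yb|/ltW yb] := leP y b; first exact: inc.
have [xb|/ltW xb] := leP b x; first exact: out.
have [h1 h2] := inc _ _ xb (lexx b); have [h3 h4] := out _ _ (lexx b) yb.
by split; lra.
Qed.

(** A point on the arc is the image under [squash] of some point of [A], by surjectivity of [amass]
    on [A]. A point off the arc has a representative beyond [b], where [squash] is the identity. *)
Let closed_arcP t : (exists2 s, A s & expi (squash s) = expi t) /\ closed_arc a b (expi t)
  \/ (exists2 s, b <= s <= a + 2 * pi & expi s = expi t) /\ ~ closed_arc a b (expi t).
Proof.
have A0 : A !=set0.
  apply/set0P/negP => /eqP A0; by move: muA; rewrite A0 measure0 ltxx.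
have [[s /= sab se]|h] := pselect (closed_arc a b (expi t)); last first.
  right; split => //; have [s /andP[as1 sb] se] := expi_rep a t.
  exists s => //; rewrite (ltW sb) andbT leNgt; apply/negP => sb'; apply: h.
  by exists s => //=; rewrite in_itv /= as1 ltW.
left; split; last by exists s.
rewrite in_itv /= in sab; case/andP: sab => as_ sb.
have [|x Ax xE] := @amass_onto ((s - a) / c) _ A0.
  have c0 : 0 < c by rewrite (lt_le_trans _ c1).
  rewrite divr_ge0 ?subr_ge0 ?(ltW c0) //= ler_pdivrMr // /c mulrC mulfVK ?gt_eqF //.
  by rewrite lerB.
exists x => //; rewrite /squash xE max_l; last first.
  by have := Aab Ax; rewrite /= in_itv /= subr_le0 => /andP[].
have c0 : c != 0 by rewrite gt_eqF // (lt_le_trans _ c1).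
by rewrite mulrC mulfVK // addr0 addrC subrK.
Qed.

(* [squash] collapses the complement of [A] in the arc, and stretches [A] by the
   factor [c] so that the end points of the arc stay fixed: pulling points back
   through it costs at most this factor in every distance. *)
Lemma pull_into n (x : 'I_n -> R) : exists y : 'I_n -> R,
  (forall j, A (y j) \/ expi (y j) = expi (x j) /\ ~ closed_arc a b (expi (x j))) /\
  (forall j k, normc (expi (x j) - expi (x k)) <= c * normc (expi (y j) - expi (y k))).
Proof.
have pt t : exists s, [/\ a <= s <= a + 2 * pi, expi (squash s) = expi t &
    A s \/ expi s = expi t /\ ~ closed_arc a b (expi t)].
  have [[[s As se] _]|[[s /andP[bs s2] se] na]] := closed_arcP t; exists s; split => //.
  - have := Aab As; rewrite /= in_itv /= => /andP[-> sb] /=; exact: le_trans sb b2pi.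
  - by left.
  - by rewrite s2 andbT (le_trans _ bs) // ltW.
  - by rewrite squash_out.
  - by right.
have [y yP] := boolp.choice (fun j => pt (x j)).
exists y; split=> [j|j k]; first by have [] := yP j.
have [yj ej _] := yP j; have [yk ek _] := yP k.
rewrite -ej -ek; apply: (@chord_contract _ c a squash) => //.
- exact: squash_left.
- exact: squash_out.
by move=> u v _ uv _; apply: squash_lip.
Qed.

End Pull.

(** * Finite unions of arcs *)

Section Arcs.
Variable R : realType.
Local Notation C := R[i].
Local Notation mu := (@lebesgue_measure R).
Implicit Types (a b c : R) (s : seq (R * R)).

(** Within one period half the difference of two distinct angles lies strictly between 0 and [pi],
    so the chord is positive. *)
Lemma expi_inj a x y : a <= x < a + 2 * pi -> a <= y < a + 2 * pi ->
  expi x = expi y -> x = y.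
Proof.
suff wl u v : a <= u -> v < a + 2 * pi -> u < v -> expi u <> expi v.
  move=> /andP[ax xa] /andP[ay ya] xy; apply/eqP; case: ltgtP => // h.
    by case: (wl x y).
  by case: (wl y x).
move=> au va uv euv.
have := chord v u; rewrite euv subrr normc0 => /esym/eqP.
rewrite mulf_eq0 pnatr_eq0 /= normr_eq0 gt_eqF //.
by apply: sin_gt0_pi; apply/andP; split; lra.
Qed.

Lemma closed_arc_shift a b a' : expi a' = expi a ->
  closed_arc a b = closed_arc a' (a' + (b - a)).
Proof.
move=> ea; apply/seteqP; split => z [t /=]; rewrite in_itv /= => /andP[h1 h2] <-.
  exists (a' + (t - a)); first by rewrite /= in_itv /=; apply/andP; split; lra.
  by rewrite expiD ea -expiD addrC subrK.
exists (a + (t - a')); first by rewrite /= in_itv /=; apply/andP; split; lra.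
by rewrite expiD -ea -expiD addrC subrK.
Qed.

Definition arcs s : set C := [set z | exists2 p, p \in s & closed_arc p.1 p.2 z].

(** Nondegenerate arcs given by angles inside [Lambda], so that [f] can be integrated over the
    parameter intervals. *)
Definition proper_arcs s := forall p, p \in s -> - pi <= p.1 /\ p.1 < p.2 /\ p.2 <= pi.

Lemma closed_arc_full a b : a + 2 * pi <= b -> closed_arc a b = range (@expi R).
Proof.
move=> ab; apply/seteqP; split => z [t /= _ <-]; first by exists t.
have [y /andP[ay ya] <-] := expi_rep a t.
by exists y => //=; rewrite in_itv /= ay /= ltW // (lt_le_trans ya).
Qed.

Lemma closed_arc_normal a b : a < b ->
  exists s, proper_arcs s /\ closed_arc a b = arcs s.
Proof.
move=> ab; have p0 := pi_gt0 R.
have [full|ba] := leP (a + 2 * pi) b.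
  exists [:: (- pi, pi)]; split; first by move=> p; rewrite inE => /eqP -> /=; lra.
  rewrite closed_arc_full // -(@closed_arc_full (- pi) pi); last by lra.
  apply/seteqP; split => z; first by exists (- pi, pi); rewrite ?inE.
  by move=> [p]; rewrite inE => /eqP ->.
have [a' /andP[a1 a2] ea] := expi_rep (- pi) a.
rewrite (closed_arc_shift b ea); set b' := a' + (b - a); have b'E : b' = a' + (b - a) by [].
move: b' b'E => b' b'E.
have [b'p|b'p] := leP b' pi.
  exists [:: (a', b')]; split; first by move=> p; rewrite inE => /eqP -> /=; lra.
  apply/seteqP; split => z; first by exists (a', b'); rewrite ?inE.
  by move=> [p]; rewrite inE => /eqP ->.
(* The arc crosses the angle [pi]: it is cut there, and the rest is shifted back by one period. *)
exists [:: (a', pi); (- pi, b' - 2 * pi)]; split.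
  by move=> p; rewrite !inE => /orP[]/eqP -> /=; lra.
have e2 t : expi (t - 2 * pi) = expi t :> C.
  by rewrite -[RHS](expi_per _ 1) -(expi_per _ 2); congr expi; lra.
apply/seteqP; split => z.
  move=> [t /=]; rewrite in_itv /= => /andP[h1 h2] <-.
  have [tp|tp] := leP t pi.
    by exists (a', pi); rewrite ?inE ?eqxx //; exists t => //=; rewrite in_itv /= h1.
  exists (- pi, b' - 2 * pi); rewrite ?inE ?eqxx ?orbT //.
  by exists (t - 2 * pi) => //=; rewrite in_itv /=; apply/andP; split; lra.
move=> [p]; rewrite !inE => /orP[]/eqP -> [t /=]; rewrite in_itv /= => /andP[h1 h2] <-.
  by exists t => //=; rewrite in_itv /= h1 (le_trans h2) // ltW.
exists (t + 2 * pi); last by rewrite -e2 addrK.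
by rewrite /= in_itv /=; apply/andP; split; lra.
Qed.

Lemma bigcup_arc_normal m (a b : 'I_m -> R) : (forall i, a i < b i) ->
  exists s, proper_arcs s /\
    \bigcup_(i in [set: 'I_m]) closed_arc (a i) (b i) = arcs s.
Proof.
move=> ab; have [s sP] := boolp.choice (fun i => closed_arc_normal (ab i)).
exists (flatten [seq s i | i <- enum 'I_m]); split.
  by move=> p /flatten_mapP[i _ pi]; have [/(_ _ pi)] := sP i.
apply/seteqP; split => z.
  move=> [i _]; have [_ ->] := sP i; move=> [p ps pz]; exists p => //.
  by apply/flatten_mapP; exists i => //; rewrite mem_enum.
move=> [p /flatten_mapP[i _ ps] pz]; exists i => //.
by have [_ ->] := sP i; exists p.
Qed.

Lemma arcs_normc s z : arcs s z -> normc z = 1.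
Proof. by move=> [p _ [t _ <-]]; apply: normc_expi. Qed.

(** On a nondegenerate interval [expi] is injective, so a finite image would make the interval
    finite, hence null. The interval is half-open because [-pi] and [pi] have the same image. *)
Lemma arcs_infinite s : proper_arcs s -> arcs s !=set0 -> infinite_set (arcs s).
Proof.
move=> sP [_ [p ps _]] fs; have [h1 [h2 h3]] := sP _ ps.
have inj : {in `[p.1, p.2[%classic &, injective (@expi R)}.
  move=> x y; rewrite !inE /= !in_itv /= => /andP[x1 x2] /andP[y1 y2].
  by apply: (@expi_inj p.1); apply/andP; split; lra.
have : finite_set `[p.1, p.2[%classic.
  rewrite -(eq_finite_set (inj_card_eq inj)); apply: sub_finite_set fs.
  move=> z [t /=]; rewrite in_itv /= => /andP[t1 t2] <-; exists p => //.
  by exists t => //=; rewrite in_itv /= t1 ltW.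
move=> /finite_set_countable/countable_lebesgue_measure0/eqP.
by rewrite lebesgue_measure_itv /= lte_fin h2 -EFinB eqe gt_eqF // subr_gt0.
Qed.

(** Induction on the arcs, each costing one factor [c]. The invariant is that every point is good up
    to a period or lies on an arc still to be treated; a step moves points into [A], hence into [G],
    or leaves their images fixed. *)
Lemma pull_into_arcs s (G : set R) c : 1 <= c ->
  (forall p, p \in s -> [/\ p.1 < p.2, p.2 <= p.1 + 2 * pi &
     exists A : set R, [/\ compact A, A `<=` `[p.1, p.2], A `<=` G, 0 < fine (mu A) &
       (p.2 - p.1) / fine (mu A) <= c]]) ->
  forall n (x : 'I_n -> R),
    (forall j, (exists2 g, G g & expi g = expi (x j)) \/ arcs s (expi (x j))) ->
  exists y : 'I_n -> R, (forall j, G (y j)) /\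
    forall j k, normc (expi (x j) - expi (x k)) <=
                c ^+ size s * normc (expi (y j) - expi (y k)).
Proof.
move=> c1; elim: s => [|p s IH] sP n x xP.
  have pt j : exists g, G g /\ expi g = expi (x j).
    by have [[g Gg <-]|[p]] := xP j; [exists g|rewrite in_nil].
  have [y yP] := boolp.choice pt.
  exists y; split => [j|j k]; first by have [] := yP j.
  by have [_ ej] := yP j; have [_ ek] := yP k; rewrite ej ek; rewrite expr0 mul1r.
have [h1 h2 [A [cA Ap AG A0 Ac]]] := sP p (mem_head _ _).
have [y [yA yx]] := pull_into h1 Ap cA h2 A0 x.
have [|j|z [zG zy]] := IH _ n y.
- by move=> q qs; apply: sP; rewrite inE qs orbT.
- have [/AG Gy|[-> npx]] := yA j; first by left; exists (y j).
  have [|[q]] := xP j; first by left.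
  by rewrite inE => /orP[/eqP -> //|qs qx]; right; exists q.
exists z; split => // j k; apply: le_trans (yx j k) _.
have q0 : 0 <= (p.2 - p.1) / fine (mu A) by rewrite divr_ge0 ?subr_ge0 // ltW.
by rewrite exprS -(mulrA c); apply: ler_pM => //; exact: normc_ge0.
Qed.

Lemma vdm_expand c n (x y : 'I_n -> C) : 1 <= c ->
  (forall j k, normc (x j - x k) <= c * normc (y j - y k)) ->
  vdm x <= c ^+ (n * n) * vdm y.
Proof.
move=> c1 xy.
have -> : c ^+ (n * n) * vdm y = \prod_(j < n) (c ^+ n * \prod_(k < n | (j < k)%N) normc (y j - y k)).
  by rewrite big_split /= prodr_const card_ord exprM.
apply: ler_prod => j _; rewrite prodr_ge0 => [|k _]; last exact: normc_ge0.
apply: (@le_trans _ _ (\prod_(k < n | (j < k)%N) (c * normc (y j - y k)))).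
  by apply: ler_prod => k _; rewrite normc_ge0 xy.
rewrite big_split /= prodr_const; apply: ler_wpM2r.
  by apply: prodr_ge0 => k _; apply: normc_ge0.
apply: ler_weXn2l => //; apply: leq_trans (max_card _) _; by rewrite card_ord.
Qed.

End Arcs.

(** * Prediction error polynomials *)

Section ErrPoly.
Variable R : realType.
Local Notation C := R[i].
Implicit Types (P : {poly C}) (f : R -> R) (x l : R).

(** This is [1 - sum c_k z^-(k+1)] multiplied by [z^n], which reverses the order of the coefficients
    and has modulus 1 on the circle. *)
Definition errpoly n (c : 'I_n -> C) : {poly C} :=
  'X^n - \poly_(i < n) (if insub i is Some j then c (rev_ord j) else 0).

Lemma errpoly_monic n (c : 'I_n -> C) : errpoly c \is monic.
Proof. by rewrite monicE lead_coefDl ?lead_coefXn // size_polyN size_polyXn ltnS size_poly. Qed.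

Lemma size_errpoly n (c : 'I_n -> C) : size (errpoly c) = n.+1.
Proof. by rewrite size_polyDl size_polyXn // size_polyN ltnS size_poly. Qed.

Lemma errpoly_onto n P : P \is monic -> size P = n.+1 ->
  exists c : 'I_n -> C, errpoly c = P.
Proof.
move=> Pm sP; exists (fun k => - P`_(rev_ord k)); apply/polyP => i.
rewrite coefB coefXn coef_poly; case: ltngtP => h.
- by rewrite (insubT (fun k => k < n)%N h) rev_ordK /= sub0r opprK.
- by rewrite subr0 nth_default // sP.
by rewrite subr0 h; move/eqP: Pm; rewrite lead_coefE sP.
Qed.

Lemma normc_errpoly n (c : 'I_n -> C) x :
  normc (1 - \sum_(k < n) c k * expi (- ((k.+1)%:R * x))) = normc (errpoly c).[expi x].
Proof.
rewrite -[LHS]mul1r -[X in X * _ = _](expr1n _ n) -[X in X ^+ n](normc_expi x) -normcX -normcM.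
congr normc; rewrite /errpoly hornerD hornerN hornerXn horner_poly mulrBr mulr1.
congr (_ - _); rewrite mulr_sumr (reindex_inj rev_ord_inj) /=; apply: eq_bigr => k _.
rewrite valK /= mulrCA; congr (c _ * _).
rewrite -expiMn -expiD -expiMn; congr expi.
rewrite subnSK // natrB; last exact: ltnW.
by ring.
Qed.

(** Horner's scheme in real coordinates; it serves the continuity, and so the measurability, of
    [sqmod]. *)
Lemma continuous_ReIm_horner P :
  continuous (fun x => complex.Re P.[expi x]) /\ continuous (fun x => complex.Im P.[expi x]).
Proof.
elim/poly_ind: P => [|P c [IHr IHi]].
  by split; under eq_fun do rewrite horner0 /=; exact: cst_continuous.
have E x : (P * 'X + c%:P).[expi x] = P.[expi x] * expi x + c by rewrite hornerMXaddC.
have Er x : complex.Re (P * 'X + c%:P).[expi x] =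
    complex.Re P.[expi x] * cos x - complex.Im P.[expi x] * sin x + complex.Re c.
  by rewrite E; case: (P.[_]) => ? ?; case: c {E} => ? ?.
have Ei x : complex.Im (P * 'X + c%:P).[expi x] =
    complex.Re P.[expi x] * sin x + complex.Im P.[expi x] * cos x + complex.Im c.
  by rewrite E; case: (P.[_]) => ? ?; case: c {E Er} => ? ?.
split; [under eq_fun do rewrite Er|under eq_fun do rewrite Ei] => x;
  (apply: cvgD; last exact: cvg_cst).
- by apply: cvgB; apply: cvgM; [exact: IHr|exact: continuous_cos|exact: IHi|exact: continuous_sin].
- by apply: cvgD; apply: cvgM; [exact: IHr|exact: continuous_sin|exact: IHi|exact: continuous_cos].
Qed.

Definition sqmod P x : R := normc P.[expi x] ^+ 2.

Lemma continuous_sqmod P : continuous (sqmod P).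
Proof.
have E x : sqmod P x = complex.Re P.[expi x] ^+ 2 + complex.Im P.[expi x] ^+ 2.
  by rewrite /sqmod; case: (P.[_]) => u v /=; rewrite sqr_sqrtr // addr_ge0 ?sqr_ge0.
have [cr ci] := continuous_ReIm_horner P.
rewrite (funext E).
by move=> x; apply: cvgD; apply: cvgM; solve [exact: cr|exact: ci].
Qed.

Lemma sqmod_ge0 P x : 0 <= sqmod P x.
Proof. exact: sqr_ge0. Qed.

Lemma sqmod_bounded P : exists M, forall x, sqmod P x <= M.
Proof.
exists ((\sum_(i < size P) normc P`_i) ^+ 2) => x.
rewrite /sqmod lerXn2r ?nnegrE ?normc_ge0 ?sumr_ge0 // => [i _|]; first exact: normc_ge0.
rewrite horner_coef; apply: le_trans (normc_sum _ _ _) _.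
by apply: ler_sum => i _; rewrite normcM normcX normc_expi expr1n mulr1.
Qed.

End ErrPoly.

(** * Integrals against a spectral density *)

Lemma exists_common_pos (R : realType) (T : eqType) (s : seq T) (Q : T -> R -> Prop) :
  (forall p e e', Q p e -> 0 < e' -> e' <= e -> Q p e') ->
  (forall p, p \in s -> exists2 e, 0 < e & Q p e) ->
  exists2 e, 0 < e & forall p, p \in s -> Q p e.
Proof.
move=> Qd; elim: s => [|p s IH] sQ; first by exists 1.
have [e e0 Qe] := sQ p (mem_head _ _).
have [|e' e'0 Qe'] := IH; first by move=> q qs; apply: sQ; rewrite inE qs orbT.
have m0 : 0 < Num.min e e' by rewrite lt_min e0.
exists (Num.min e e') => // q; rewrite inE => /orP[/eqP ->|qs].
  by apply: (Qd _ e) => //; rewrite ge_min lexx.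
by apply: (Qd _ e'); [exact: Qe'| |rewrite ge_min lexx orbT].
Qed.

Section SpectralDensity.
Variable R : realType.
Local Notation C := R[i].
Local Notation mu := (@lebesgue_measure R).
Local Notation mR := (measurableTypeR R).
Local Notation Lambda := (@Lambda R).
Variable f : R -> R.
Hypothesis sf : spectral_density f.

Let f0 x : Lambda x -> 0 <= f x. Proof. by case: sf => + _ _; apply. Qed.
Let fi : mu.-integrable Lambda (EFin \o f). Proof. by case: sf. Qed.
Let mL : @measurable _ mR Lambda. Proof. exact: measurable_itv. Qed.
Let mf : measurable_fun (Lambda : set mR) f.
Proof. by apply/measurable_EFinP; exact: measurable_int fi. Qed.

Let msq (P : {poly C}) : measurable_fun (Lambda : set mR) (sqmod P).
Proof.
apply: measurable_funTS; apply: continuous_measurable_fun; exact: continuous_sqmod.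
Qed.

Lemma integrable_sqmod (P : {poly C}) :
  mu.-integrable Lambda (EFin \o (fun l => sqmod P l * f l)).
Proof.
have [M PM] := sqmod_bounded P.
apply: (@le_integrable _ _ _ mu _ mL _ (fun x => (M%:E * (EFin \o f) x)%E)).
- by apply/(@measurable_EFinP _ mR); apply: measurable_funM.
- move=> x Lx /=; rewrite lee_fin normrM [leRHS]normrM ler_wpM2r //.
  by rewrite ger0_norm ?sqmod_ge0 // (le_trans (PM x)) // ler_norm.
- by apply: integrableZl; [exact: mL|exact: fi].
Qed.

Definition polyerr (P : {poly C}) : R := Rintegral mu Lambda (fun l => sqmod P l * f l).

Lemma polyerr_ge0 P : 0 <= polyerr P.
Proof. by apply: Rintegral_ge0 => x Lx; rewrite mulr_ge0 ?sqmod_ge0 ?f0. Qed.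

Lemma pred_err2E n :
  pred_err2 n f = inf (range (fun c : 'I_n -> C => polyerr (errpoly c))).
Proof.
rewrite /pred_err2; congr inf; apply: eq_imagel => c _; apply: eq_Rintegral => l _.
by rewrite /sqmod normc_errpoly.
Qed.

Lemma pred_err2_le n (P : {poly C}) : P \is monic -> size P = n.+1 ->
  pred_err2 n f <= polyerr P.
Proof.
move=> Pm sP; have [c <-] := errpoly_onto Pm sP; rewrite pred_err2E.
have lb : has_lbound (range (fun c : 'I_n -> C => polyerr (errpoly c))).
  by exists 0 => _ [d _ <-]; exact: polyerr_ge0.
by apply: (ge_inf lb); exists c.
Qed.

Lemma pred_err2_lt n y : pred_err2 n f < y ->
  exists P : {poly C}, [/\ P \is monic, size P = n.+1 & polyerr P < y].
Proof.
rewrite pred_err2E => /inf_lt[|_ [c _ <-] cy].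
  by exists (polyerr (errpoly (fun _ : 'I_n => 0 : C))), (fun=> 0).
by exists (errpoly c); rewrite errpoly_monic size_errpoly.
Qed.

Lemma pred_err2_ge0 n : 0 <= pred_err2 n f.
Proof.
rewrite pred_err2E; apply: lb_le_inf; first by exists (polyerr (errpoly (fun _ : 'I_n => 0 : C))), (fun=> 0).
by move=> _ [c _ <-]; apply: polyerr_ge0.
Qed.

(** Where [f] vanishes the integrand does too, so a bound on the spectrum suffices. *)
Lemma polyerr_le_sup (P : {poly C}) (M : R) :
  (forall l, Lambda l -> 0 < f l -> normc P.[expi l] <= M) ->
  polyerr P <= M ^+ 2 * Rintegral mu Lambda f.
Proof.
move=> PM; rewrite -RintegralZl //; apply: le_Rintegral => //.
- exact: integrable_sqmod.
- exact: (@integrableZl _ _ _ mu Lambda mL (M ^+ 2) _ fi).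
move=> l Ll; have [fl|] := ltP 0 (f l).
  rewrite ler_wpM2r ?(ltW fl) // /sqmod lerXn2r ?nnegrE ?normc_ge0 ?PM //.
  by apply: le_trans (PM _ Ll fl); apply: normc_ge0.
by move=> fl; have -> : f l = 0; [apply/le_anti; rewrite fl f0|rewrite !mulr0].
Qed.

Lemma measurable_flt (B : set R) (e : R) : @measurable _ mR B -> B `<=` Lambda ->
  @measurable _ mR (B `&` [set x | f x < e]).
Proof.
move=> mB BL; have := measurable_fun_ltr (measurable_funS mL BL mf) (measurable_cst e).
by move=> /(_ mB [set true] I).
Qed.

(** The sets where [f] is below [1/(n+1)] decrease to a subset of the exceptional null set; their
    measures tend to 0 by continuity from above. *)
Lemma small_set_f (U : set R) (d : R) : @measurable _ mR U -> U `<=` Lambda ->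
  {ae mu, forall l, U l -> 0 < f l} -> 0 < d ->
  exists2 e : R, 0 < e & (mu (U `&` [set x | (f x < e)%R]) < d%:E)%E.
Proof.
move=> mU UL fpos d0.
pose F (n : nat) := U `&` [set x | f x < n.+1%:R^-1].
have mF n : @measurable _ mR (F n) by apply: measurable_flt.
have mFc : @measurable _ mR (\bigcap_n F n) by exact: bigcap_measurable.
have Fcap : mu (\bigcap_n F n) = 0%E.
  apply/(@negligibleP _ mR) => //; apply: negligibleS fpos => x Fx /= fx.
  have Ux : U x by have [] := Fx 0%N I.
  have fx0 := fx Ux.
  have [_ /=] := Fx (Num.truncn (f x)^-1) I; apply/negP; rewrite -leNgt.
  rewrite -[leRHS]invrK lef_pV2 ?posrE ?invr_gt0 //.
  by apply/ltW/truncnS_gt.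
have cF : mu (F n) @[n --> \oo] --> (0 : \bar R).
  rewrite -Fcap; apply: nonincreasing_cvg_mu => //.
  - apply: (@le_lt_trans _ _ (mu Lambda)).
      apply: le_measure; [by rewrite inE; exact: (mF 0%N)|by rewrite inE; exact: mL|].
      by move=> x [/UL].
    by rewrite lebesgue_measure_itv /=; case: ifP => _; rewrite -?EFinB ltry.
  - move=> m n mn; apply/subsetPset => x [Ux /= fx]; split => //=.
    by apply: lt_le_trans fx _; rewrite lef_pV2 ?posrE ?ltr0n // ler_nat.
have : \forall n \near \oo, (mu (F n) < d%:E)%E.
  exact: (cF _ (@nbhs_open_ereal_lt _ 0 (fun=> d) d0)).
move=> [k _ /(_ k (leqnn k)) /= Fk].
by exists k.+1%:R^-1 => //; rewrite invr_gt0.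
Qed.

Lemma measurable_fge_sqmod (P : {poly C}) (e M : R) :
  @measurable _ mR (Lambda `&` [set x | (e <= f x) && (M < sqmod P x)]).
Proof.
have := measurable_and (measurable_fun_ler (measurable_cst e) mf)
  (measurable_fun_ltr (measurable_cst M) (msq P)).
by move=> /(_ mL [set true] I).
Qed.

(** Markov's inequality: the integrand of [polyerr P] is at least [e * M] on this set. *)
Lemma sqmod_markov (P : {poly C}) (e M : R) : 0 < e -> 0 < M ->
  (mu (Lambda `&` [set x | (e <= f x)%R && (M < sqmod P x)%R]) <= (polyerr P / (e * M))%R%:E)%E.
Proof.
move=> e0 M0; set B := (X in mu X).
have mB : @measurable _ mR B by exact: measurable_fge_sqmod.
have BL : B `<=` Lambda by move=> x [].
have mh : measurable_fun (Lambda : set mR) (fun x => (sqmod P x * f x)%R%:E).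
  exact: measurable_int (integrable_sqmod P).
have h : ((e * M)%R%:E * mu B <= (polyerr P)%:E)%E.
  rewrite -integral_cst // /polyerr /Rintegral fineK; last first.
    exact: integrable_fin_num (integrable_sqmod P).
  apply: (@le_trans _ _ (\int[mu]_(x in B) (sqmod P x * f x)%R%:E)%E).
    apply: ge0_le_integral => //.
    - by move=> x _; rewrite lee_fin mulr_ge0 // ltW.
    - exact: measurable_funS mL BL mh.
    - move=> x [_ /= /andP[ef Msq]]; rewrite lee_fin mulrC; apply: ler_pM => //; exact: ltW.
  apply: ge0_subset_integral => //.
  by move=> x Lx; rewrite lee_fin mulr_ge0 ?sqmod_ge0 ?f0.
by rewrite EFinM lee_pdivlMr ?mulr_gt0 // muleC.
Qed.

End SpectralDensity.

(** * Growth of the maximal Vandermonde product *)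

Section Growth.
Variable R : realType.
Local Notation C := R[i].
Local Notation mu := (@lebesgue_measure R).
Local Notation mR := (measurableTypeR R).
Local Notation Lambda := (@Lambda R).

Lemma vdm_le_mixed (E : set C) (P : {poly C}) n m M (w : 'I_(n + m) -> C) :
  (forall z, E z -> normc z = 1) -> infinite_set E ->
  P \is monic -> size P = n.+1 -> 0 <= M ->
  (forall j, E (w j) /\ normc P.[w j] <= M) ->
  vdm w <= (n + m)`!%:R * (2 ^+ n * maxvdm E n) * M ^+ m.
Proof.
move=> E1 Einf Pm sP M0 wM.
have [F FP] := boolp.choice (exists_small_monic E1 Einf).
(* Near-optimal polynomials below degree [n], shifts of [P] from there on; the shifts keep the bound
   [M] because the points have modulus 1. *)
pose Q (k : 'I_(n + m)) := if (k < n)%N then F k else 'X^(k - n) * P.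
pose B (k : 'I_(n + m)) := if (k < n)%N then 2 * (maxvdm E k.+1 / maxvdm E k) else M.
have h : vdm w <= (n + m)`!%:R * \prod_k B k.
  apply: (@vdm_le_monic _ _ _ Q).
  - move=> k; rewrite /Q; case: ifP => _; first by have [] := FP k.
    by rewrite monicMl ?monicXn.
  - move=> k; rewrite /Q; case: ltnP => kn; first by have [] := FP k.
    by rewrite size_monicM ?monicXn ?monic_neq0 // size_polyXn sP; lia.
  - move=> k j; have [Ew Pw] := wM j; rewrite /Q /B; case: ifP => _.
      by have [_ _] := FP k; apply.
    by rewrite hornerM hornerXn normcM normcX E1 // expr1n mul1r.
apply: le_trans h _; rewrite -mulrA ler_wpM2l // big_split_ord /=.
have -> : \prod_(i < m) B (rshift n i) = M ^+ m.
  under eq_bigr do rewrite /B /= ltnNge leq_addr /=.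
  by rewrite prodr_const card_ord.
rewrite ler_wpM2r ?exprn_ge0 //.
have -> : \prod_(i < n) B (lshift m i) = \prod_(i < n) (2 * (maxvdm E i.+1 / maxvdm E i)).
  by apply: eq_bigr => i _; rewrite /B /= ltn_ord.
rewrite big_split /= prodr_const card_ord ler_wpM2l ?exprn_ge0 //.
have V0 k : maxvdm E k != 0 by rewrite gt_eqF // maxvdm_gt0.
have -> : \prod_(i < n) (maxvdm E i.+1 / maxvdm E i) = maxvdm E n / maxvdm E 0.
  elim: (n) => [|k IH]; first by rewrite big_ord0 divff.
  by rewrite big_ord_recr /= IH; field; rewrite !V0.
(* The telescoped product is [maxvdm E n / maxvdm E 0], and the empty product shows that the
   denominator is at least 1. *)
rewrite ler_pdivrMr ?maxvdm_gt0 // ler_peMr ?(ltW (maxvdm_gt0 _ _ _)) //.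
have /(_ 0%N (fun=> 0)) := vdm_le_max E1 Einf.
by rewrite /vdm big_ord0; apply; case.
Qed.

Variables (f : R -> R) (s : seq (R * R)).
Hypotheses (sf : spectral_density f) (sP : proper_arcs s).
Hypothesis fpos : {ae mu, forall l, Lambda l -> arcs s (expi l) -> 0 < f l}.

Let subL p : p \in s -> `[p.1, p.2] `<=` Lambda.
Proof.
move=> ps x /=; have [h1 [h2 h3]] := sP ps; rewrite /Defs.Lambda /= !in_itv /= => /andP[x1 x2].
by apply/andP; split; lra.
Qed.

(** The constant [K] comes before [P]: it depends on [f], the arcs and [c] only, which makes the
    growth estimate uniform in the degree. *)
Lemma good_compact c : 1 < c -> exists2 K, 0 < K &
  forall (P : {poly C}) r, 0 < r -> polyerr f P <= r ^+ 2 ->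
  forall p, p \in s -> exists A : set R, [/\ compact A, A `<=` `[p.1, p.2],
    A `<=` [set l | arcs s (expi l) /\ normc P.[expi l] <= K * r],
    0 < fine (mu A) & (p.2 - p.1) / fine (mu A) <= c].
Proof.
move=> c1; have c0 : 0 < c by lra.
(* Three sets of measure at most [d] get lost: where [f] is small, where [P] is large, and in
   passing to a compact subset. What is left of an arc has at least [1/c] of its length. *)
have [|p ps|d d0 dP] := @exists_common_pos R _ s (fun p d => 3 * d <= (p.2 - p.1) * (1 - c^-1)).
- by move=> p e e' h _ h'; apply: le_trans h; lra.
- have [h1 [h2 h3]] := sP ps.
  exists ((p.2 - p.1) * (1 - c^-1) / 3); last by lra.
  by rewrite divr_gt0 // mulr_gt0 ?subr_gt0 // invf_lt1.
have [|p ps|e e0 eP] := @exists_common_pos R _ s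
    (fun p e => p \in s /\ (mu (`[p.1, p.2] `&` [set x | (f x < e)%R]) < d%:E)%E).
- move=> p e e' [ps h] e'0 e'e; split => //; apply: le_lt_trans h.
  by apply: le_measure; rewrite ?inE //; [exact: measurable_flt (subL ps)|
    exact: measurable_flt (subL ps)|move=> x [xp /= fx]; split => //=; exact: lt_le_trans e'e].
- have [|e e0 eP] := small_set_f sf (measurable_itv `[p.1, p.2]) (subL ps) _ d0; last by exists e.
  move: fpos; apply: negligibleS => x /= nx fx; apply: nx => xp; apply: fx; first exact: subL xp.
  by exists p => //; exists x.
(* With this value Markov's inequality at level [(K r)^2] gives the measure bound
   [r^2 / (e K^2 r^2) = d]. *)
exists (Num.sqrt (e * d)^-1); first by rewrite sqrtr_gt0 invr_gt0 mulr_gt0.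
move=> P r r0 Pr p ps; have [h1 [h2 h3]] := sP ps.
set K := Num.sqrt _; have K2 : K ^+ 2 = (e * d)^-1.
  by rewrite sqr_sqrtr // invr_ge0 mulr_ge0 // ltW.
have K0 : 0 < K by rewrite sqrtr_gt0 invr_gt0 mulr_gt0.
pose M := (K * r) ^+ 2; have M0 : 0 < M by rewrite exprn_gt0 // mulr_gt0.
pose I := `[p.1, p.2]%classic : set R.
pose B1 := I `&` [set x | f x < e].
pose B2 := Lambda `&` [set x | (e <= f x) && (M < sqmod P x)].
have mI : @measurable _ mR I by exact: measurable_itv.
have mB1 : @measurable _ mR B1 by apply: measurable_flt => //; exact: subL.
have mB2 : @measurable _ mR B2 by exact: measurable_fge_sqmod.
have B1d : (mu B1 < d%:E)%E by have [] := eP p ps.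
have B2d : (mu B2 <= d%:E)%E.
  apply: le_trans (sqmod_markov sf P e0 M0) _; rewrite lee_fin ler_pdivrMr ?mulr_gt0 //.
  apply: le_trans Pr _; rewrite /M exprMn K2 le_eqVlt; apply/orP; left; apply/eqP.
  by field; rewrite !gt_eqF.
pose D := I `\` (B1 `|` B2).
have mD : @measurable _ mR D by apply: measurableD => //; exact: measurableU.
have muI : mu I = (p.2 - p.1)%:E by rewrite lebesgue_measure_itv /= lte_fin h2 EFinB.
have Dfin : (mu D < +oo)%E.
  apply: (@le_lt_trans _ _ (mu I)); last by rewrite muI ltry.
  by apply: le_measure; rewrite ?inE // => x [].
have [A [cA AD DAd]] := lebesgue_regularity_inner mD Dfin d0.
have mA : @measurable _ mR A by apply: compact_measurable.
have AI : A `<=` I by move=> x /AD[].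
have Afin : mu A \is a fin_num.
  rewrite ge0_fin_numE //; apply: le_lt_trans Dfin.
  by apply: le_measure; rewrite ?inE.
have muIA : p.2 - p.1 <= fine (mu A) + 3 * d.
  have cover : I `<=` A `|` ((D `\` A) `|` (B1 `|` B2)).
    move=> x Ix; have [|nB] := pselect ((B1 `|` B2) x); first by right; right.
    by have [|nA] := pselect (A x); [left|right; left].
  have mDA : @measurable _ mR (D `\` A) by exact: measurableD.
  have mB : @measurable _ mR (B1 `|` B2) by exact: measurableU.
  have mDAB : @measurable _ mR ((D `\` A) `|` (B1 `|` B2)) by exact: measurableU.
  rewrite -lee_fin -muI EFinD fineK //.
  have q0 : (mu I <= mu (A `|` ((D `\` A) `|` (B1 `|` B2))))%E.
    by apply: le_measure; rewrite ?inE //; exact: measurableU.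
  have q1 := measureU2 mu mA mDAB.
  have q2 := measureU2 mu mDA mB.
  have q3 := measureU2 mu mB1 mB2.
  have -> : (3 * d)%:E = (d%:E + (d%:E + d%:E))%E by rewrite -!EFinD; congr EFin; lra.
  apply: (le_trans q0); apply: (le_trans q1); apply: leeD => //.
  apply: (le_trans q2); apply: leeD; first exact: ltW.
  by apply: (le_trans q3); apply: leeD => //; exact: ltW.
have Age : (p.2 - p.1) / c <= fine (mu A) by have := dP _ ps; rewrite mulrBr mulr1; lra.
have A0 : 0 < fine (mu A) by apply: lt_le_trans Age; rewrite divr_gt0 // subr_gt0.
exists A; split => //.
- move=> x /AD[Ix nB]; split; first by exists p => //; exists x.
  rewrite leNgt; apply/negP => KP; apply: nB; have [fe|fe] := ltP (f x) e; [by left|right].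
  split; first exact: subL Ix.
  by rewrite /= fe /= /sqmod /M ltr_pXn2r // ?nnegrE ?normc_ge0 ?mulr_ge0 // ltW.
- by rewrite ler_pdivrMr // mulrC -ler_pdivrMr.
Qed.

Hypothesis Einf : infinite_set (arcs s).

Lemma maxvdm_growth c : 1 < c -> exists2 K, 0 < K &
  forall n m (P : {poly C}) r, P \is monic -> size P = n.+1 -> 0 < r ->
  polyerr f P <= r ^+ 2 ->
  maxvdm (arcs s) (n + m) <= (c ^+ size s) ^+ ((n + m) * (n + m)) *
    ((n + m)`!%:R * (2 ^+ n * maxvdm (arcs s) n) * (K * r) ^+ m).
Proof.
move=> c1; have [K K0 KP] := good_compact c1; exists K => // n m P r Pm sPn r0 Pr.
have E1 := @arcs_normc R s.
apply: maxvdm_le => // z Ez.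
have pt j : exists t, expi t = z j by have [p _ [t _ <-]] := Ez j; exists t.
have [x xz] := boolp.choice pt.
pose G := [set l | arcs s (expi l) /\ normc P.[expi l] <= K * r].
have [p ps|j|y [yG yx]] := @pull_into_arcs R s G c (ltW c1) _ (n + m) x.
- have [h1 [h2 h3]] := sP ps; split => //; first by lra.
  exact: KP _ _ r0 Pr p ps.
- by right; rewrite xz.
have -> : vdm z = vdm (fun j => expi (x j)).
  by congr vdm; apply/funext => j; rewrite xz.
apply: le_trans (vdm_expand (y := fun j => expi (y j)) _ yx) _; first exact: exprn_ege1 (ltW c1).
rewrite ler_wpM2l ?exprn_ge0 //; first by lra.
apply: (vdm_le_mixed E1 Einf Pm sPn _ yG); by rewrite mulr_ge0 // ltW.
Qed.

End Growth.

(** * The limit *)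

Section Limit.
Variable R : realType.
Local Notation C := R[i].
Local Notation mu := (@lebesgue_measure R).
Local Notation Lambda := (@Lambda R).

(** From [n! <= n^n] and [e n <= exp (e n)]: the factorial contributes only [e n^2 + O(n)] to the
    exponent, for any [e > 0]. *)
Lemma fact_le_expR (e : R) n : 0 < e ->
  n`!%:R <= expR (n%:R * (e * n%:R - ln e)).
Proof.
move=> e0; apply: (@le_trans _ _ (n%:R ^+ n)).
  rewrite -natrX ler_nat.
  suff fk k : (k <= n)%N -> (k`! <= n ^ k)%N by exact: fk.
  elim: k => [|k IH] kn; first by rewrite fact0 expn0.
  by rewrite factS expnS leq_mul // IH // ltnW.
rewrite expRM_natl; apply: lerXn2r; rewrite ?nnegrE ?expR_ge0 //.
rewrite expRD expRN lnK ?posrE // ler_pdivlMr // mulrC.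
by apply: le_trans (expR_ge1Dx _); rewrite lerDr.
Qed.

(* [m] is about [n / q]: the errors on the right are [O(e n^2)] and
   [L m^2 / 2], both small compared with [m n]. *)
Lemma growth_absurd (n m q L rho e B k : R) :
  rho < L -> 2 <= q -> 1 <= m -> m <= n -> q * (m - 1) <= n -> n <= q * m ->
  2 * `|L| <= q * (L - rho) -> e = (L - rho) / (36 * q) ->
  4 * (2 * `|B| + 1 + `|k|) <= m * (L - rho) ->
  (n + m) * (n + m - 1) / 2 * L <=
    e * (n + m) ^+ 2 + (n + m) * (e * (n + m) + B) + n
    + n * (n - 1) / 2 * (L + e) + m * (k + n * rho) -> False.
Proof.
move=> rL q2 m1 mn qm nq Lq eE mB.
have D0 : 0 < L - rho by lra.
set D := L - rho in D0 Lq eE mB *.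
have -> : rho = L - D by rewrite /D; lra.
have q0 : 0 < q by lra.
have m0 : 0 < m by lra.
have n0 : 0 < n by lra.
have f1 : - (m * (m - 1) / 2 * L) <= m * n * D / 4.
  have a1 : - L <= `|L| by rewrite -normrN ler_norm.
  have a2 : (m - 1) * - L <= n * D / 2.
    apply: (@le_trans _ _ ((m - 1) * (q * D / 2))).
      by apply: ler_wpM2l; lra.
    have : q * (m - 1) * D <= n * D by rewrite ler_wpM2r // ltW.
    by move=> h; lra.
  have : m * ((m - 1) * - L) <= m * (n * D / 2) by rewrite ler_wpM2l // ltW.
  by move=> h; lra.
have e0 : 0 < e by rewrite eE divr_gt0 // mulr_gt0.
have f2 : e * n ^+ 2 <= m * n * D / 36.
  have -> : m * n * D / 36 = e * (n * (q * m)) by rewrite eE; field; rewrite gt_eqF.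
  by rewrite ler_wpM2l ?(ltW e0) // expr2 ler_wpM2l // ltW.
have f3 : e * (n + m) ^+ 2 <= 4 * (e * n ^+ 2).
  rewrite (mulrCA 4) ler_wpM2l ?(ltW e0) //.
  have -> : 4 * n ^+ 2 = (2 * n) ^+ 2 by ring.
  by apply: lerXn2r; rewrite ?nnegrE; lra.
have f4 : (n + m) * B <= n * (2 * `|B|).
  apply: (@le_trans _ _ ((n + m) * `|B|)); first by rewrite ler_wpM2l ?ler_norm //; lra.
  by rewrite mulrA ler_wpM2r ?normr_ge0 //; lra.
have f5 : m * k <= n * `|k|.
  apply: (@le_trans _ _ (m * `|k|)); first by rewrite ler_wpM2l ?ler_norm //; lra.
  by rewrite ler_wpM2r ?normr_ge0.
have f6 : n * (4 * (2 * `|B| + 1 + `|k|)) <= n * (m * D) by rewrite ler_wpM2l // ltW.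
have f7 : n * (n - 1) / 2 * e <= e * n ^+ 2 / 2.
  have : 0 <= n * e by rewrite mulr_ge0 // ltW.
  by move=> h; nra.
have f8 : 0 < m * n * D by rewrite !mulr_gt0.
(* The errors amount to at most [1/4 + 2/9 + 1/4 + 1/72 < 1] times [m n D]: from [L m^2 / 2], the
   two terms [e (n+m)^2], the linear terms, and the excess [e] over [L]. *)
move=> main.
have E1 : (n + m) * (n + m - 1) / 2 * L = n * (n - 1) / 2 * L + m * n * L + m * (m - 1) / 2 * L by field.
have E2 : (n + m) * (e * (n + m) + B) = e * (n + m) ^+ 2 + (n + m) * B by ring.
have E3 : m * (k + n * (L - D)) = m * k + m * n * L - m * n * D by ring.
have E4 : n * (n - 1) / 2 * (L + e) = n * (n - 1) / 2 * L + n * (n - 1) / 2 * e by ring.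
rewrite E1 E2 E3 E4 in main.
lra.
Qed.

Variables (f : R -> R) (s : seq (R * R)).
Hypotheses (sf : spectral_density f) (sP : proper_arcs s).
Hypothesis fpos : {ae mu, forall l, Lambda l -> arcs s (expi l) -> 0 < f l}.
Hypothesis fsupp : forall l, Lambda l -> 0 < f l -> arcs s (expi l).
Hypothesis Einf : infinite_set (arcs s).

Local Notation E := (arcs s).
Local Notation tau := (transfinite_diameter E).
Let E1 := @arcs_normc R s.

Lemma pred_err_le_diam n : (1 < n)%N ->
  pred_err n f <= (2 * Num.sqrt (Rintegral mu Lambda f)) * diam_n n E ^+ n.
Proof.
move=> n1; have [P [Pm sPn Psup]] := exists_small_monic E1 Einf n.
set M := 2 * (_ / _) in Psup.
have M0 : 0 <= M by rewrite mulr_ge0 // divr_ge0 // ltW // maxvdm_gt0.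
have PM l : Lambda l -> 0 < f l -> normc P.[expi l] <= M.
  by move=> Ll fl; apply: Psup; apply: fsupp.
have h := le_trans (pred_err2_le sf Pm sPn) (polyerr_le_sup sf PM).
apply: (@le_trans _ _ (M * Num.sqrt (Rintegral mu Lambda f))).
  by rewrite /pred_err -[X in X * _](ger0_norm M0) -sqrtr_sqr -sqrtrM ?sqr_ge0 // ler_wsqrtr.
rewrite /M -mulrA [X in 2 * X]mulrC mulrA ler_wpM2l ?mulr_ge0 ?sqrtr_ge0 //.
exact: maxvdm_ratio.
Qed.

Lemma pred_err_ge_expR rho : 0 < tau -> rho < ln tau ->
  \forall n \near \oo, expR (n%:R * rho) <= pred_err n f.
Proof.
move=> tau0 rL; set L := ln tau in rL.
have alg (S N u : R) : 0 <= S -> S * (N * N) * (u / (S + 1)) = S / (S + 1) * (u * N ^+ 2).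
  by move=> S0; field; apply: lt0r_neq0; lra.
have D0 : 0 < L - rho by lra.
(* Large enough for [2 |L| <= q (L - rho)], and at least 2 so that [m <= n] below. *)
pose q := (Num.truncn (2 * `|L| / (L - rho))).+2.
have q0 : 0 < q%:R :> R by rewrite ltr0n.
have Lq : 2 * `|L| <= q%:R * (L - rho).
  rewrite -ler_pdivrMr //; apply/ltW; apply: lt_trans (truncnS_gt _) _.
  by rewrite ltr_nat.
pose e := (L - rho) / (36 * q%:R).
have e0 : 0 < e by rewrite divr_gt0 // mulr_gt0.
(* All arcs together then cost at most [exp e] per unit of [(n+m)^2]; the successor avoids a
   division by 0. *)
pose c := expR (e / (size s).+1%:R).
have c1 : 1 < c by rewrite expR_gt1 divr_gt0.
have [K K0 KP] := maxvdm_growth sf sP fpos Einf c1.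
pose T := 4 * (2 * `|ln e| + 1 + `|ln K|).
have near_d : \forall n \near \oo, diam_n n E < expR (L + e).
  have : tau < expR (L + e) by rewrite -[ltLHS]lnK ?posrE // ltr_expR ltrDl.
  by move=> h; apply: (cvgr_lt _ (diam_cvg E1 Einf)).
near=> n.
have n2 : (1 < n)%N by near: n; exact: nbhs_infty_gt.
have dn : diam_n n E < expR (L + e) by near: n.
have nT : T * q%:R / (L - rho) <= n%:R by near: n; exact: nbhs_infty_ger.
rewrite leNgt; apply/negP => err.
pose r := expR (n%:R * rho); have r0 : 0 < r by exact: expR_gt0.
have err2 : pred_err2 n f < r ^+ 2.
  rewrite -[ltLHS](sqr_sqrtr (pred_err2_ge0 sf n)).
  by rewrite ltr_pXn2r // nnegrE ?sqrtr_ge0 ?ltW.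
have [P [Pm sPn /ltW Pr]] := pred_err2_lt err2.
(* Hence [q (m - 1) <= n < q m]. *)
pose m := (n %/ q).+1.
have mn : (m <= n)%N.
  by rewrite /m /q; apply: (@leq_ltn_trans (n %/ 2)); [apply: leq_div2l|rewrite ltn_Pdiv // ltnW].
have main := KP n m P r Pm sPn r0 Pr.
have V0 k : 0 < maxvdm E k by exact: maxvdm_gt0.
have N2 : (1 < n + m)%N by rewrite (leq_trans n2) // leq_addr.
have a1 : (c ^+ size s) ^+ ((n + m) * (n + m)) <= expR (e * (n%:R + m%:R) ^+ 2).
  rewrite -exprM -expRM_natl ler_expR !natrM natrD.
  rewrite /c -natr1 alg //.
  apply: ler_piMl; first by rewrite mulr_ge0 ?sqr_ge0 // ltW.
  by rewrite natr1 ler_pdivrMr ?ltr0n // mul1r ler_nat.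
have a2 := fact_le_expR (n + m) e0.
have a3 : 2 ^+ n <= expR n%:R :> R.
  rewrite -[n%:R]mulr1 expRM_natl lerXn2r ?nnegrE ?expR_ge0 //.
  by apply: le_trans (expR_ge1Dx 1).
have a4 : maxvdm E n <= expR (n%:R * (n%:R - 1) / 2 * (L + e)).
  rewrite -[leLHS]lnK ?posrE // ler_expR ln_maxvdm //.
  rewrite ler_wpM2l ?divr_ge0 ?mulr_ge0 ?subr_ge0 ?ler1n ?(ltnW n2) //.
  by rewrite -[leRHS]expRK ler_ln ?posrE ?expR_gt0 ?diam_gt0 // ltW.
have a5 : (K * r) ^+ m = expR (m%:R * (ln K + n%:R * rho)).
  by rewrite expRM_natl expRD lnK.
have a6 : expR ((n%:R + m%:R) * (n%:R + m%:R - 1) / 2 * L) <= maxvdm E (n + m).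
  rewrite -[leRHS]lnK ?posrE // ler_expR ln_maxvdm // -natrD.
  rewrite ler_wpM2l ?divr_ge0 ?mulr_ge0 ?subr_ge0 ?ler1n ?(ltnW N2) //.
  by rewrite ler_ln ?posrE ?diam_gt0 // transfinite_diameter_le.
have := le_trans a6 main; rewrite leNgt => /negP; apply.
have cge : 0 <= c by apply: ltW; apply: lt_trans c1.
apply: (@le_lt_trans _ _ (expR (e * (n%:R + m%:R) ^+ 2) *
   (expR ((n + m)%:R * (e * (n + m)%:R - ln e)) * (expR n%:R * expR (n%:R * (n%:R - 1) / 2 * (L + e)))
     * expR (m%:R * (ln K + n%:R * rho))))).
  rewrite a5; apply: ler_pM => //; rewrite ?exprn_ge0 //.
    by rewrite !mulr_ge0 ?expR_ge0 ?exprn_ge0 // ltW.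
  apply: ler_pM => //; rewrite ?expR_ge0 //.
    by rewrite !mulr_ge0 ?exprn_ge0 // ltW.
  apply: ler_pM => //.
    by rewrite !mulr_ge0 ?exprn_ge0 // ltW.
  by apply: ler_pM => //; rewrite ?exprn_ge0 // ltW.
rewrite -!expRD ltr_expR ltNge; apply/negP => big.
apply: (@growth_absurd n%:R m%:R q%:R L rho e (- ln e) (ln K)) => //.
- by rewrite ler_nat.
- by rewrite ler1n.
- by rewrite ler_nat.
- by rewrite /m -natr1 addrK -natrM ler_nat mulnC leq_trunc_div.
- by rewrite -natrM ler_nat /m mulnC ltnW // ltn_ceil.
- rewrite normrN -/T -(ler_pM2r q0); rewrite ler_pdivrMr // in nT.
  apply: (le_trans nT); rewrite mulrAC ler_wpM2r ?(ltW D0) //.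
  by rewrite -natrM ler_nat /m ltnW // ltn_ceil.
- by move: big; rewrite natrD !addrA.
Unshelve. all: by end_near. Qed.

Lemma pred_err_cvg : (fun n : nat => pred_err n f `^ (n%:R^-1)) @ \oo --> tau.
Proof.
(* Adding 1 makes the constant positive, so that [M] has a logarithm and its [n]-th root tends to
   1. *)
pose M := 2 * Num.sqrt (Rintegral mu Lambda f) + 1.
have M0 : 0 < M by rewrite ltr_wpDl // mulr_ge0 ?sqrtr_ge0.
have ub : (fun n => M `^ (n%:R^-1) * diam_n n E) @ \oo --> tau.
  rewrite -[X in _ --> X]mul1r; apply: cvgM; last exact: diam_cvg.
  have inv0 : (fun n : nat => n%:R^-1 : R) @ \oo --> (0 : R).
    by rewrite -cvg_shiftS; exact: cvg_harmonic.
  have -> : (fun n : nat => M `^ n%:R^-1) = (fun n : nat => expR (n%:R^-1 * ln M)).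
    by apply/funext => n; rewrite /powR gt_eqF.
  have : (fun n : nat => n%:R^-1 * ln M) @ \oo --> (0 : R).
    by rewrite -[X in _ --> X](mul0r (ln M)); apply: cvgM => //; exact: cvg_cst.
  by move=> /(continuous_cvg _ (@continuous_expR R 0)); rewrite expR0.
apply/cvgrPdist_le => eps eps0.
have near_ub : \forall n \near \oo, M `^ (n%:R^-1) * diam_n n E < tau + eps.
  by apply: (cvgr_lt _ ub); rewrite ltrDl.
have near_lb : \forall n \near \oo, tau - eps <= pred_err n f `^ n%:R^-1.
  (* If [tau - eps <= 0], in particular if [tau = 0], the lower bound is trivial; otherwise
     [tau > 0] and the exponential bound applies with rate [ln (tau - eps)]. *)
  have [neg|pos] := leP (tau - eps) 0.
    by near=> n; apply: le_trans neg _; apply: powR_ge0.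
  have tau0 : 0 < tau by lra.
  have rL : ln (tau - eps) < ln tau.
    by rewrite ltr_ln ?posrE //; lra.
  have near_ge := pred_err_ge_expR tau0 rL; near=> n.
  have n0 : n%:R != 0 :> R.
    by rewrite pnatr_eq0 -lt0n; near: n; exact: nbhs_infty_gt.
  have -> : tau - eps = expR (n%:R * ln (tau - eps)) `^ n%:R^-1.
    by rewrite -expRM mulrAC divff // mul1r lnK.
  apply: ge0_ler_powR; rewrite ?nnegrE ?invr_ge0 ?expR_ge0 ?sqrtr_ge0 //.
  by near: n.
near=> n.
have n2 : (1 < n)%N by near: n; exact: nbhs_infty_gt.
have lb : tau - eps <= pred_err n f `^ n%:R^-1 by near: n.
have ubn : M `^ (n%:R^-1) * diam_n n E < tau + eps by near: n.
have up : pred_err n f `^ n%:R^-1 <= M `^ (n%:R^-1) * diam_n n E.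
  have n0 : n%:R != 0 :> R by rewrite pnatr_eq0; lia.
  have d0 := diam_gt0 E1 Einf n2.
  have -> : diam_n n E = (diam_n n E ^+ n) `^ n%:R^-1.
    by rewrite -powR_mulrn ?(ltW d0) // -powRrM divff // powRr1 // ltW.
  rewrite -powRM ?(ltW M0) ?exprn_ge0 ?(ltW d0) //.
  apply: ge0_ler_powR; rewrite ?nnegrE ?invr_ge0 ?sqrtr_ge0 ?mulr_ge0 ?(ltW M0) ?exprn_ge0 ?(ltW d0) //.
  apply: le_trans (pred_err_le_diam n2) _.
  by rewrite ler_wpM2r ?exprn_ge0 ?(ltW d0) // lerDl.
by rewrite ler_norml; apply/andP; split; lra.
Unshelve. all: by end_near. Qed.

End Limit.

(** * Reduction of the theorem to arcs inside one period *)

Unset Implicit Arguments.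
Set Strict Implicit.
Set Printing Implicit Defensive.

Theorem mainTheorem1 (R : realType) (f : R -> R) :
  spectral_density f ->
  (exists (m : nat) (a b : 'I_m -> R),
      (forall i, a i < b i) /\
      closure (spectrum f) = \bigcup_(i in [set: 'I_m]) closed_arc (a i) (b i)) ->
  {ae lebesgue_measure, forall l : R,
      Lambda l -> closure (spectrum f) (expi l) -> 0 < f l} ->
  (fun n : nat => pred_err n f `^ (n%:R^-1)) @ \oo
    --> transfinite_diameter (closure (spectrum f)).
Proof.
move=> sf [m [a [b [ab Eab]]]] fpos.
have [s [sP sE]] := bigcup_arc_normal ab.
have Es : closure (spectrum f) = arcs s by rewrite Eab.
have fsupp l : Lambda l -> 0 < f l -> arcs s (expi l).
  by move=> Ll fl; rewrite -Es; apply: subset_closure; exists l.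
rewrite Es in fpos *.
apply: (pred_err_cvg sf sP fpos fsupp); apply: (arcs_infinite sP).
(* The positive measure of the set where [f > 0] yields a point of the spectrum, so there is at
   least one arc and the set is infinite. *)
have [_ _] := sf; have [-> |] := eqVneq (@Defs.Lambda R `&` [set x | 0 < f x]) set0.
  by rewrite measure0 ltxx.
by move=> /set0P[l [Ll fl]] _; exists (expi l); apply: fsupp.
Qed.
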